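(* Let $R$ be a commutative noetherian ring with a dualizing complex, and let $\mathsf{Mor}$ be the abelian category of homomorphisms of $R$-modules. The Gorenstein projective objects of $\mathsf{Mor}$ are precisely the injective homomorphisms between Gorenstein projective $R$-modules which have Gorenstein projective cokernels.
   Context: $\mathsf{Mor}$ has as objects the homomorphisms $\alpha:X_\alpha\to T_\alpha$ of $R$-modules; a morphism from $\alpha$ to $\beta$ is a pair $(f_X:X_\alpha\to X_\beta,\ f_T:T_\alpha\to T_\beta)$ of $R$-module homomorphisms with $\beta f_X=f_T\alpha$. In $\mathsf{Mor}$, as well as in the category of $R$-modules, a complex $\pi$ of projective objects is called totally acyclic if it is exact and $\mathrm{Hom}(\pi,\varphi)$ is exact for each projective object $\varphi$. A Gorenstein projective object is a cycle object of a totally acyclic complex of projective objects. *)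

(* Defs.v *)
From HB Require Import structures.
From mathcomp Require Import all_boot all_order all_algebra.
From mathcomp Require Import boolp.

Set Implicit Arguments.
Unset Strict Implicit.
Unset Printing Implicit Defensive.

Import GRing.Theory Num.Theory.
Local Open Scope ring_scope.

(* A category with zero morphisms. The notions below are only used in abelian
   categories, where the zero morphism is the zero of the abelian group of
   morphisms; the rest of the additive structure is not needed to express
   them. *)
Record category := Category {
  ob :> Type;
  hom_set : ob -> ob -> Type;
  idm : forall A, hom_set A A;
  compm : forall A B C, hom_set B C -> hom_set A B -> hom_set A C;
  zerom : forall A B, hom_set A B;
  compA : forall A B C D (h : hom_set C D) (g : hom_set B C) (f : hom_set A B),
    compm h (compm g f) = compm (compm h g) f;
  comp1m : forall A B (f : hom_set A B), compm (idm B) f = f;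
  compm1 : forall A B (f : hom_set A B), compm f (idm A) = f;
  comp0m : forall A B C (f : hom_set A B), compm (zerom B C) f = zerom A C;
  compm0 : forall A B C (g : hom_set B C), compm g (zerom A B) = zerom A C
}.

Arguments hom_set {c}.
Arguments idm {c}.
Arguments compm {c A B C}.
Arguments zerom {c}.

Notation "g \oc f" := (compm g f) (at level 50, left associativity).

Section Categorical.
Variable C : category.
Implicit Types A B P : C.

Definition is_mono A B (f : hom_set A B) : Prop :=
  forall X (u v : hom_set X A), f \oc u = f \oc v -> u = v.

Definition is_epi A B (f : hom_set A B) : Prop :=
  forall X (u v : hom_set B X), u \oc f = v \oc f -> u = v.

Definition projective_object P : Prop :=
  forall A B (e : hom_set A B), is_epi e ->
  forall f : hom_set P B, exists g : hom_set P A, e \oc g = f.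

Definition injective_object I : Prop :=
  forall A B (m : hom_set A B), is_mono m ->
  forall f : hom_set A I, exists g : hom_set B I, g \oc m = f.

Definition is_kernel A B K (f : hom_set A B) (k : hom_set K A) : Prop :=
  f \oc k = zerom K B /\
  forall X (u : hom_set X A), f \oc u = zerom X B ->
  exists! v : hom_set X K, k \oc v = u.

Definition is_cokernel A B Q (f : hom_set A B) (q : hom_set B Q) : Prop :=
  q \oc f = zerom A Q /\
  forall X (u : hom_set B X), u \oc f = zerom A X ->
  exists! v : hom_set Q X, v \oc q = u.

(* Exactness at B: f induces an epimorphism from A onto the kernel of g. *)
Definition exact_at A B D (f : hom_set A B) (g : hom_set B D) : Prop :=
  exists K (k : hom_set K B) (e : hom_set A K),
    [/\ is_kernel g k, is_epi e & f = k \oc e].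

(* A complex indexed by the integers. The differential is given between
   arbitrary indices, but only the components d i (i + 1) can be nonzero; this
   avoids transporting morphisms along equations between indices. *)
Record complex := Complex {
  cob :> int -> C;
  cd : forall i j, hom_set (cob i) (cob j);
  cd_shape : forall i j, j != i + 1 -> cd i j = zerom (cob i) (cob j);
  cd_cd : forall i j k, cd j k \oc cd i j = zerom (cob i) (cob k)
}.

Definition exact_complex (X : complex) : Prop :=
  forall n, exact_at (cd X (n - 1) n) (cd X n (n + 1)).

(* Exactness, for all n, of the sequence of abelian groups
   Hom(X (n + 1), F) -> Hom(X n, F) -> Hom(X (n - 1), F). *)
Definition exact_hom_into (X : complex) (F : C) : Prop :=
  forall n (g : hom_set (X n) F), g \oc cd X (n - 1) n = zerom (X (n - 1)) F ->
  exists h : hom_set (X (n + 1)) F, g = h \oc cd X n (n + 1).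

Definition totally_acyclic (X : complex) : Prop :=
  [/\ forall n, projective_object (X n),
      exact_complex X &
      forall F, projective_object F -> exact_hom_into X F].

Definition gorenstein_projective (M : C) : Prop :=
  exists X : complex, totally_acyclic X /\
  exists n (k : hom_set M (X n)), is_kernel (cd X n (n + 1)) k.

End Categorical.

Section Modules.
Variable R : comPzRingType.

Lemma linear_eq (M N : lmodType R) (f g : {linear M -> N}) :
  (forall x, f x = g x) -> f = g.
Proof.
case: f g => [f [[af] [sf]]] [g [[ag] [sg]]] /= fg.
have {fg} efg : f = g by apply: funext.
move: af sf ag sg; rewrite efg => af sf ag sg.
by rewrite (Prop_irrelevance af ag) (Prop_irrelevance sf sg).
Qed.

Definition lin_id (M : lmodType R) : {linear M -> M} := idfun.
Definition lin_comp (L M N : lmodType R)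
  (g : {linear M -> N}) (f : {linear L -> M}) : {linear L -> N} := g \o f.
Definition lin_zero (M N : lmodType R) : {linear M -> N} := \0.

Definition Mod : category.
Proof.
refine (@Category (lmodType R) (fun M N => {linear M -> N})
          lin_id lin_comp lin_zero _ _ _ _ _).
- by move=> *; apply: linear_eq.
- by move=> *; apply: linear_eq.
- by move=> *; apply: linear_eq.
- by move=> *; apply: linear_eq.
- by move=> A B C g; apply: linear_eq => x /=; rewrite linear0.
Defined.

Record morob := MorOb {
  msrc : lmodType R;
  mtgt : lmodType R;
  marr : {linear msrc -> mtgt}
}.

Record morhom (a b : morob) := MorHom {
  fsrc : {linear msrc a -> msrc b};
  ftgt : {linear mtgt a -> mtgt b};
  fsq : lin_comp (marr b) fsrc = lin_comp ftgt (marr a)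
}.

Lemma morhom_eq a b (f g : morhom a b) :
  fsrc f = fsrc g -> ftgt f = ftgt g -> f = g.
Proof.
case: f g => [f1 f2 ef] [g1 g2 eg] /= e1 e2.
by case: _ / e1 eg; case: _ / e2 => eg; rewrite (Prop_irrelevance ef eg).
Qed.

Lemma mor_id_sq (a : morob) :
  lin_comp (marr a) (lin_id (msrc a)) = lin_comp (lin_id (mtgt a)) (marr a).
Proof. by apply: linear_eq. Qed.

Lemma mor_comp_sq a b c (g : morhom b c) (f : morhom a b) :
  lin_comp (marr c) (lin_comp (fsrc g) (fsrc f)) =
  lin_comp (lin_comp (ftgt g) (ftgt f)) (marr a).
Proof.
case: g f => [g1 g2 eg] [f1 f2 ef] /=; apply: linear_eq => x /=.
have /(congr1 (fun h : {linear _ -> _} => h (f1 x))) /= -> := eg.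
by have /(congr1 (fun h : {linear _ -> _} => h x)) /= -> := ef.
Qed.

Lemma mor_zero_sq (a b : morob) :
  lin_comp (marr b) (lin_zero (msrc a) (msrc b)) =
  lin_comp (lin_zero (mtgt a) (mtgt b)) (marr a).
Proof. by apply: linear_eq => x /=; rewrite linear0. Qed.

Definition mor_id (a : morob) : morhom a a := MorHom (mor_id_sq a).
Definition mor_comp (a b c : morob) (g : morhom b c) (f : morhom a b) :
  morhom a c := MorHom (mor_comp_sq g f).
Definition mor_zero (a b : morob) : morhom a b := MorHom (mor_zero_sq a b).

Definition Mor : category.
Proof.
refine (@Category morob morhom mor_id mor_comp mor_zero _ _ _ _ _).
- by move=> *; apply: morhom_eq; apply: linear_eq.
- by move=> *; apply: morhom_eq; apply: linear_eq.
- by move=> *; apply: morhom_eq; apply: linear_eq.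
- by move=> *; apply: morhom_eq; apply: linear_eq.
- by move=> a b c g; apply: morhom_eq; apply: linear_eq => x /=;
    rewrite linear0.
Defined.

Definition ideal (I : R -> Prop) : Prop :=
  [/\ I 0, forall x y, I x -> I y -> I (x + y) & forall r x, I x -> I (r * x)].

Definition noetherian : Prop :=
  forall I, ideal I -> exists n (g : 'I_n -> R), (forall i, I (g i)) /\
  forall x, I x -> exists c : 'I_n -> R, x = \sum_(i < n) c i * g i.

Section Dualizing.
Variable D : complex Mod.

Definition cterm (i : int) : lmodType R := D i.
Definition cdiff (i j : int) : {linear cterm i -> cterm j} := cd D i j.

Definition bounded_complex : Prop :=
  exists N : int, forall i, N < `|i| -> forall x : cterm i, x = 0.

(* ker (cdiff i (i + 1)) / im (cdiff (i - 1) i) is finitely generated. *)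
Definition fg_homology : Prop :=
  forall i, exists n (g : 'I_n -> cterm i),
  (forall m, cdiff i (i + 1) (g m) = 0) /\
  forall z : cterm i, cdiff i (i + 1) z = 0 ->
  exists (c : 'I_n -> R) (y : cterm (i - 1)),
    z = \sum_(m < n) c m *: g m + cdiff (i - 1) i y.

(* An element of degree p of the complex Hom(D, D), i.e. of the product over i
   of the modules Hom(D i, D (i + p)), is represented by a family f of which
   only the components f i j with j = i + p are used; hom_diff p f is its
   differential, of which only the components with j = i + p + 1 are used. *)
Definition cochain := forall i j : int, {linear cterm i -> cterm j}.

Definition hom_diff (p : int) (f : cochain) (i j : int) (x : cterm i) :
    cterm j :=
  cdiff (j - 1) j (f i (j - 1) x)
    - (-1) ^+ `|p|%N *: f (i + 1) j (cdiff i (i + 1) x).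

Definition hom_cycle (p : int) (f : cochain) : Prop :=
  forall i (x : cterm i), hom_diff p f (i + p + 1) x = 0.

(* The homothety map from R, in degree 0, to Hom(D, D) is bijective in homology:
   the homology of Hom(D, D) vanishes in degrees p != 0, and the induced map to
   its homology in degree 0 is onto and has zero kernel. *)
Definition homothety_quasi_iso : Prop :=
  [/\ forall p f, p != 0 -> hom_cycle p f ->
        exists h : cochain, forall i (x : cterm i),
          f i (i + p) x = hom_diff (p - 1) h (i + p) x,
      forall f, hom_cycle 0 f ->
        exists r (h : cochain), forall i (x : cterm i),
          f i i x = r *: x + hom_diff (-1) h i x &
      forall r (h : cochain),
        (forall i (x : cterm i), r *: x = hom_diff (-1) h i x) -> r = 0].

(* Finite injective dimension is expressed on a representative consisting of
   injective modules, so that Hom(D, D) computes the derived RHom(D, D). *)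
Definition dualizing : Prop :=
  [/\ bounded_complex, forall i, injective_object (D i), fg_homology &
      homothety_quasi_iso].

End Dualizing.

End Modules.

Arguments Mod R : clear implicits.
Arguments Mor R : clear implicits.

(* Main.v *)
(** The projective objects of Mor are the split monomorphisms between projective
    modules. So a totally acyclic complex in Mor is a degreewise split exact
    sequence of complexes 0 -> P -> T -> Q -> 0, and testing it against the
    projectives (F = F) and (0 -> F) shows that T and Q, hence P, are totally
    acyclic; taking cycles gives the properties of the source, the target and
    the cokernel. Conversely, let X -> T be injective with cokernel C, and let P
    and Q be totally acyclic complexes with cycles X and C. A lift to T of the
    cover of C by a term of Q determines a map into X from the preceding term,
    hence a map sigma from Q to P of degree 1 anticommuting with the
    differentials; the split inclusion of P into P (+) Q with differential
    (p, z) |-> (d p + sigma z, d z) is totally acyclic in Mor, with cycle object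
    X -> T. *)

From HB Require Import structures.
Require Import Defs.
From mathcomp Require Import all_boot all_order all_algebra.
From mathcomp Require Import boolp.
From mathcomp Require Import generic_quotient ring_quotient.
From mathcomp Require Import zify.
Set Implicit Arguments.
Unset Strict Implicit.
Unset Printing Implicit Defensive.
Import GRing.Theory Num.Theory.
Local Open Scope ring_scope.

(** * Module homomorphisms: factorizations, quotients, and elementwise forms of the categorical
    notions *)

Section LinearMaps.
Variable R : comPzRingType.
Implicit Types K L M N Q : lmodType R.

Definition mklin M N (f : M -> N) (lf : linear f) : {linear M -> N} :=
  HB.pack f (GRing.isLinear.Build R M N *:%R f lf).

Lemma lin_congr M N (f g : {linear M -> N}) : f = g -> forall x, f x = g x.
Proof. by move=> ->. Qed.

Definition surj (A B : Type) (f : A -> B) := forall y, exists x, f x = y.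

Lemma lin_injP M N (f : {linear M -> N}) :
  (forall x, f x = 0 -> x = 0) -> injective f.
Proof.
move=> f0 x y e; apply/eqP; rewrite -subr_eq0; apply/eqP/f0.
by rewrite linearB e subrr.
Qed.

Lemma factor_surj L M N (e : {linear L -> M}) (f : {linear L -> N}) :
  surj e -> (forall x, e x = 0 -> f x = 0) ->
  exists g : {linear M -> N}, forall x, g (e x) = f x.
Proof.
move=> e_surj ef0.
have wd x y : e x = e y -> f x = f y.
  move=> exy; apply/eqP; rewrite -subr_eq0 -linearB; apply/eqP/ef0.
  by rewrite linearB exy subrr.
have /choice[g gE] : forall y, exists z, forall x, e x = y -> f x = z.
  by move=> y; have [x <-] := e_surj y; exists (f x) => x' /wd.
have {}gE x : g (e x) = f x by rewrite -(gE (e x) x).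
have lg : linear g.
  move=> a u v; have [x <-] := e_surj u; have [y <-] := e_surj v.
  by rewrite -linearP !gE linearP.
by exists (mklin lg).
Qed.

Lemma factor_inj L M N (k : {linear M -> N}) (u : {linear L -> N}) :
  injective k -> (forall x, exists y, k y = u x) ->
  exists v : {linear L -> M}, forall x, k (v x) = u x.
Proof.
move=> k_inj /choice[v vE].
have lv : linear v by move=> a x y; apply: k_inj; rewrite linearP !vE linearP.
by exists (mklin lv).
Qed.

Section Quotient.
Variables (M : lmodType R) (S : zmodClosed M).
Hypothesis S_scale : forall (a : R) x, x \in S -> a *: x \in S.
Local Open Scope quotient_scope.
Local Notation Q := {ideal_quot S}.

(** Scalars act on the canonical representative; closure of [S] under scalars makes the class
    independent of that choice, which is [quot_scaleE]. *)
Definition quot_scale (a : R) (u : Q) : Q := \pi_Q (a *: repr u).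

Lemma quot_scaleE a x : quot_scale a (\pi_Q x) = \pi_Q (a *: x).
Proof.
apply/eqP; rewrite -Quotient.idealrBE -scalerBr S_scale //.
by rewrite Quotient.idealrBE reprK.
Qed.

Fact quot_scalerA a b u : quot_scale a (quot_scale b u) = quot_scale (a * b) u.
Proof. by rewrite [quot_scale b u]/quot_scale quot_scaleE scalerA. Qed.

Fact quot_scale1r : left_id 1 quot_scale.
Proof. by move=> u; rewrite /quot_scale scale1r reprK. Qed.

Fact quot_scalerDr : right_distributive quot_scale +%R.
Proof.
move=> a u v; rewrite -{1}[u]reprK -{1}[v]reprK -raddfD quot_scaleE scalerDr.
by rewrite raddfD.
Qed.

Fact quot_scalerDl u : {morph quot_scale^~ u : a b / a + b}.
Proof. by move=> a b; rewrite /quot_scale scalerDl raddfD. Qed.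

Definition quot_module : lmodType R :=
  HB.pack Q (GRing.Zmodule_isLmodule.Build R Q
    quot_scalerA quot_scale1r quot_scalerDr quot_scalerDl).

Fact quot_proj_linear : linear (\pi_Q : M -> quot_module).
Proof.
by move=> a x y; rewrite raddfD; congr (_ + _); exact/esym/quot_scaleE.
Qed.

Definition quot_proj : {linear M -> quot_module} := mklin quot_proj_linear.

Lemma quot_proj_surj : surj quot_proj.
Proof. by move=> u; exists (repr u); exact: reprK. Qed.

Lemma quot_proj_eq0 x : quot_proj x = 0 <-> x \in S.
Proof.
rewrite -[x in x \in S]subr0 Quotient.idealrBE.
have -> : \pi_Q 0 = 0 :> Q by rewrite raddf0.
by split=> /eqP.
Qed.

End Quotient.

Lemma quotient_exists M (S : M -> Prop) : S 0 ->
  (forall a x y, S x -> S y -> S (a *: x + y)) ->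
  exists (Q : lmodType R) (p : {linear M -> Q}),
    surj p /\ forall x, p x = 0 <-> S x.
Proof.
move=> S0 Slin; pose P : {pred M} := fun x => `[< S x >].
have PZ (a : R) x : x \in P -> a *: x \in P.
  by move=> /asboolP Sx; apply/asboolP; rewrite -[_ *: _]addr0; exact: Slin.
have clP : zmod_closed P.
  split=> [|x y /asboolP Sx /asboolP Sy]; apply/asboolP => //.
  by rewrite addrC -scaleN1r; exact: Slin.
pose K : zmodClosed M := HB.pack P (GRing.isZmodClosed.Build M P clP).
exists (quot_module (PZ : forall a x, x \in K -> a *: x \in K)), (quot_proj _).
split; first exact: quot_proj_surj.
by move=> x; rewrite quot_proj_eq0; split=> /asboolP.
Qed.

Lemma coker_exists M N (f : {linear M -> N}) :
  exists (Q : lmodType R) (p : {linear N -> Q}),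
    surj p /\ forall y, p y = 0 <-> exists x, f x = y.
Proof.
apply: quotient_exists; first by exists 0; rewrite linear0.
by move=> a _ _ [x <-] [y <-]; exists (a *: x + y); rewrite linearP.
Qed.

Lemma coim_exists M N (f : {linear M -> N}) :
  exists (Q : lmodType R) (p : {linear M -> Q}),
    surj p /\ forall x, p x = 0 <-> f x = 0.
Proof.
apply: quotient_exists; first by rewrite linear0.
by move=> a x y fx fy; rewrite linearP fx fy scaler0 addr0.
Qed.

(** The image is realised as the quotient of [M] by the kernel of [f], and the inclusion is the map
    that [f] induces on this quotient. *)
Lemma image_exists M N (f : {linear M -> N}) :
  exists (Q : lmodType R) (p : {linear M -> Q}) (k : {linear Q -> N}),
    [/\ surj p, injective k & forall x, k (p x) = f x].
Proof.
have [Q [p [p_surj p0]]] := coim_exists f.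
have [k kE] := factor_surj p_surj (fun x => (p0 x).1).
exists Q, p, k; split=> //; apply: lin_injP => y; have [x <-] := p_surj y.
by rewrite kE => /p0.
Qed.

(* R^o represents the underlying-set functor, so it detects kernels elementwise. *)
Fact elt_linear M (m : M) : linear (fun a : R^o => a *: m).
Proof. by move=> a x y; rewrite scalerDl scalerA. Qed.
Definition elt M (m : M) : {linear R^o -> M} := mklin (elt_linear m).

(** The test map for surjectivity is the projection onto the cokernel of [f]: it agrees with zero
    after [f], so it vanishes when [f] is an epimorphism. *)
Lemma mod_epiP M N (f : {linear M -> N}) :
  is_epi (f : hom_set (M : Mod R) N) <-> surj f.
Proof.
split=> [epi_f y|f_surj X u v uv].
  have [Q [p [p_surj p0]]] := coker_exists f; apply/p0.
  have /lin_congr -> : p = lin_zero N Q :> {linear N -> Q}; last by [].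
  apply: (epi_f Q p); apply: linear_eq => x /=; apply/p0; by exists x.
apply: linear_eq => y; have [x <-] := f_surj y.
exact: (lin_congr uv x).
Qed.

Lemma mod_kernelP K M N (f : {linear M -> N}) (k : {linear K -> M}) :
  is_kernel (f : hom_set (M : Mod R) N) (k : hom_set (K : Mod R) M) <->
  [/\ injective k, forall x, f (k x) = 0 &
      forall y, f y = 0 -> exists x, k x = y].
Proof.
split=> [[fk0 univ]|[k_inj fk0 kerf]].
  have fk x : f (k x) = 0 := lin_congr fk0 x.
  split=> // [|y fy0].
    apply: lin_injP => x kx0.
    have [|v [_ uv]] := univ R^o (elt 0).
      by apply: linear_eq => a /=; rewrite scaler0 linear0.
    (* Both [elt x] and [elt 0] lift the zero map through [k]; uniqueness identifies them, and
       evaluation at 1 gives [x = 0]. *)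
    have e1 : v = elt x.
      by apply: uv; apply: linear_eq => a /=; rewrite linearZ kx0.
    have e2 : v = elt 0.
      by apply: uv; apply: linear_eq => a /=; rewrite !scaler0 linear0.
    by have := lin_congr (etrans (esym e1) e2) (1 : R) => /=; rewrite !scale1r.
  have [|v [kv _]] := univ R^o (elt y).
    by apply: linear_eq => a /=; rewrite linearZ fy0 /= scaler0.
  by exists (v (1 : R)); have := lin_congr kv (1 : R) => /= ->; rewrite scale1r.
split=> [|X u fu0]; first by apply: linear_eq => x; exact: fk0.
have [v vE] := factor_inj k_inj (fun x => kerf _ (lin_congr fu0 x)).
exists v; split=> [|w kw]; first exact: linear_eq.
by apply: linear_eq => x; apply: k_inj; rewrite vE -(lin_congr kw x).
Qed.

Lemma mod_cokernelP M N Q (f : {linear M -> N}) (q : {linear N -> Q}) :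
  is_cokernel (f : hom_set (M : Mod R) N) (q : hom_set (N : Mod R) Q) <->
  surj q /\ forall y, q y = 0 <-> exists x, f x = y.
Proof.
split=> [[qf0 univ]|[q_surj q0]].
  split=> [|y].
    apply/mod_epiP => X u v uv.
    have [|w [_ wE]] := univ X (v \oc q).
      apply: linear_eq => x /=.
      by have /= -> := lin_congr qf0 x; rewrite linear0.
    by rewrite -(wE u uv) -(wE v erefl).
  split=> [qy0|[x <-]]; last exact: (lin_congr qf0 x).
  have [Q' [p [p_surj p0]]] := coker_exists f; apply/p0.
  have [|w [wE _]] := univ Q' p.
    by apply: linear_eq => x /=; apply/p0; exists x.
  by have /= <- := lin_congr wE y; rewrite qy0 linear0.
split=> [|X u uf0]; first by apply: linear_eq => x /=; apply/q0; exists x.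
have [|v vE] := factor_surj q_surj (f := u).
  by move=> y /q0[x <-]; exact: (lin_congr uf0 x).
exists v; split=> [|w wq]; first exact: linear_eq.
apply: linear_eq => z; have [y <-] := q_surj z.
by rewrite vE -(lin_congr wq y).
Qed.

Lemma mod_exactP L M N (f : {linear L -> M}) (g : {linear M -> N}) :
  exact_at (f : hom_set (L : Mod R) M) (g : hom_set (M : Mod R) N) <->
  (forall x, g (f x) = 0) /\ forall y, g y = 0 -> exists x, f x = y.
Proof.
split=> [[K [k [e [/mod_kernelP[k_inj gk0 kerg] /mod_epiP e_surj fE]]]]|].
  have {}fE x : f x = k (e x) := lin_congr fE x.
  split=> [x|y /kerg[z <-]]; first by rewrite fE.
  by have [x <-] := e_surj z; exists x.
case=> gf0 kerg; have [Q [p [k [p_surj k_inj kp]]]] := image_exists f.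
exists Q, k, p; split; last by apply: linear_eq => x /=; rewrite kp.
  apply/mod_kernelP; split=> // [x|y /kerg[x <-]].
    by have [y <-] := p_surj x; rewrite kp.
  by exists (p x).
exact/mod_epiP.
Qed.

End LinearMaps.

(** * Reindexing complexes, and recursion over the integers *)

Section ComplexesAtIndices.
Variable C : category.
Implicit Types X : complex C.

(** Three indices tied by equations can be instantiated at numerals or at shifted degrees without
    transporting morphisms. *)
Lemma exact_complexP X : exact_complex X <->
  forall i j k, j = i + 1 -> k = j + 1 -> exact_at (cd X i j) (cd X j k).
Proof.
split=> [eX i j k ij ->|eX n]; last by apply: eX => //; rewrite subrK.
by have -> : i = j - 1 by rewrite ij addrK.
Qed.

Lemma exact_hom_intoP X F : exact_hom_into X F <->
  forall i j k, j = i + 1 -> k = j + 1 -> forall g : hom_set (X j) F,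
  g \oc cd X i j = zerom (X i) F ->
  exists h : hom_set (X k) F, g = h \oc cd X j k.
Proof.
split=> [eX i j k ij ->|eX n]; last by apply: eX => //; rewrite subrK.
by have -> : i = j - 1; [rewrite ij addrK | exact: eX].
Qed.

Definition shift_complex X (n : int) : complex C.
Proof.
refine (@Complex C (fun i => X (i + n)) (fun i j => cd X (i + n) (j + n)) _ _).
- move=> i j ij; apply: cd_shape; apply: contra ij => /eqP ij.
  by apply/eqP; lia.
- by move=> i j k; exact: cd_cd.
Defined.

Lemma shift_totally_acyclic X n :
  totally_acyclic X -> totally_acyclic (shift_complex X n).
Proof.
case=> projX /exact_complexP eX homX; split=> [i||F projF]; first exact: projX.
  by apply/exact_complexP => i j k -> -> /=; apply: eX; lia.
move/exact_hom_intoP: (homX F projF) => {}homX.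
by apply/exact_hom_intoP => i j k -> -> /=; apply: homX; lia.
Qed.

(** Shifting the complex moves the cycle object to any prescribed degree, so that two objects can
    later be presented as cycles in the same degree. *)
Lemma gorenstein_projective_at (n : int) (M : C) :
  gorenstein_projective M -> exists X : complex C, totally_acyclic X /\
  exists k : hom_set M (X n), is_kernel (cd X n (n + 1)) k.
Proof.
case=> X [taX [m [k kerk]]]; exists (shift_complex X (m - n)).
split; first exact: shift_totally_acyclic.
have e : m = n + (m - n) by lia.
have e1 : m + 1 = n + 1 + (m - n) by lia.
rewrite /=; move: k kerk; rewrite e1; case: _ / e => k kerk.
by exists k.
Qed.

(* Avoids transporting a single component along equations between indices. *)
Definition extend_by_zero (X : int -> C) A m (f : hom_set A (X m)) j :
    hom_set A (X j) :=
  if @eqP _ m j is ReflectT e then ecast i (hom_set A (X i)) e f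
  else zerom A (X j).

Lemma extend_by_zeroE (X : int -> C) A m (f : hom_set A (X m)) :
  extend_by_zero f m = f.
Proof.
by rewrite /extend_by_zero; case: eqP => // e; rewrite (eq_irrelevance e erefl).
Qed.

Lemma extend_by_zero_neq (X : int -> C) A m (f : hom_set A (X m)) j :
  j != m -> extend_by_zero f j = zerom A (X j).
Proof.
by rewrite /extend_by_zero; case: eqP => // e /eqP[]; rewrite e.
Qed.

End ComplexesAtIndices.

(** Two recursions start from [x0], one upward and one downward. Since [Negz n] is [- (n + 1)], the
    link between -1 and 0 is the separate step [down0]. *)
Lemma int_dependent_choice (T : int -> Type)
    (rel : forall i j, T i -> T j -> Prop) (x0 : T 0) :
  (forall i j (x : T i), j = i + 1 -> exists y : T j, rel i j x y) ->
  (forall i j (y : T j), j = i + 1 -> exists x : T i, rel i j x y) ->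
  exists x : forall i, T i,
    x 0 = x0 /\ forall i j, j = i + 1 -> rel i j (x i) (x j).
Proof.
move=> up down.
have upn (n : nat) (x : T n) : {y : T n.+1 | rel n n.+1 x y}.
  by apply: cid; apply: up; lia.
have down0 : {x : T (Negz 0) | rel (Negz 0) 0 x x0}.
  by apply: cid; apply: down.
have downn (n : nat) (y : T (Negz n)) :
    {x : T (Negz n.+1) | rel (Negz n.+1) (Negz n) x y}.
  by apply: cid; apply: down; lia.
pose u := fix u (n : nat) : T n :=
  if n is n'.+1 then sval (upn n' (u n')) else x0.
pose v := fix v (n : nat) : T (Negz n) :=
  if n is n'.+1 then sval (downn n' (v n')) else sval down0.
exists (fun i => match i with Posz n => u n | Negz n => v n end); split=> //.
move=> [n|[|n]] j.
- have -> : Posz n + 1 = n.+1 by lia.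
  by move=> ->; exact: (svalP (upn n (u n))).
- have -> : Negz 0 + 1 = 0 by [].
  by move=> ->; exact: (svalP down0).
- have -> : Negz n.+1 + 1 = Negz n by lia.
  by move=> ->; exact: (svalP (downn n (v n))).
Qed.

(** * Epimorphisms, kernels, exactness and projectives in [Mor] *)

Section Morphisms.
Variable R : comPzRingType.
Implicit Types (L M N P A B : lmodType R) (a b c : morob R).

Definition lin_add M N (f g : {linear M -> N}) : {linear M -> N} := f \+ g.
Definition lin_sub M N (f g : {linear M -> N}) : {linear M -> N} := f \- g.
Definition prodm M N : lmodType R := (M * N)%type.

Fact inl_linear M N : linear (fun x : M => (x, 0) : prodm M N).
Proof. by move=> s x y; congr pair; rewrite //= scaler0 addr0. Qed.
Definition lin_inl M N : {linear M -> prodm M N} := mklin (@inl_linear M N).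

Fact inr_linear M N : linear (fun y : N => (0, y) : prodm M N).
Proof. by move=> s x y; congr pair; rewrite //= scaler0 addr0. Qed.
Definition lin_inr M N : {linear N -> prodm M N} := mklin (@inr_linear M N).

Definition lin_fst M N : {linear prodm M N -> M} := fst.
Definition lin_snd M N : {linear prodm M N -> N} := snd.

Fact pair_linear L M N (f : {linear L -> M}) (g : {linear L -> N}) :
  linear (fun x => (f x, g x) : prodm M N).
Proof. by move=> s x y; rewrite !linearP. Qed.
Definition lin_pair L M N (f : {linear L -> M}) (g : {linear L -> N}) :
  {linear L -> prodm M N} := mklin (pair_linear f g).

Definition lin_copair L M N (f : {linear M -> L}) (g : {linear N -> L}) :
    {linear prodm M N -> L} :=
  lin_add (lin_comp f (lin_fst M N)) (lin_comp g (lin_snd M N)).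

Definition zmod : lmodType R := 'rV[R]_0.

Lemma zmod0 (x : zmod) : x = 0.
Proof. by apply/rowP => -[]. Qed.

Lemma mod_projectiveP M : projective_object (M : Mod R) <->
  forall A B (e : {linear A -> B}), surj e ->
  forall f : {linear M -> B},
  exists g : {linear M -> A}, forall x, e (g x) = f x.
Proof.
split=> projM A B e.
  move=> /mod_epiP epi_e f; have [g /lin_congr] := projM _ _ _ epi_e f.
  by exists g.
move=> /mod_epiP e_surj f; have [g gE] := projM A B e e_surj f.
by exists g; exact: linear_eq.
Qed.

Definition exact_lin L M N (f : {linear L -> M}) (g : {linear M -> N}) :=
  (forall x, g (f x) = 0) /\ forall y, g y = 0 -> exists x, f x = y.

(** By exactness [u] lands in the image of [f], onto which [L] surjects. *)
Lemma projective_lift P L M N (f : {linear L -> M}) (g : {linear M -> N}) :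
  projective_object (P : Mod R) -> exact_lin f g ->
  forall u : {linear P -> M}, (forall x, g (u x) = 0) ->
  exists v : {linear P -> L}, forall x, f (v x) = u x.
Proof.
move=> /mod_projectiveP projP [_ kerg] u gu0.
have [Q [p [k [p_surj k_inj kp]]]] := image_exists f.
have [|w wE] := factor_inj (u := u) k_inj.
  by move=> x; have [y <-] := kerg _ (gu0 x); exists (p y).
have [v vE] := projP _ _ _ p_surj w.
by exists v => x; rewrite -kp vE wE.
Qed.

Lemma morE a b (f : morhom a b) x : marr b (fsrc f x) = ftgt f (marr a x).
Proof. exact: (lin_congr (fsq f) x). Qed.

Lemma mkmor_sq a b (f : {linear msrc a -> msrc b})
    (g : {linear mtgt a -> mtgt b}) :
  (forall x, marr b (f x) = g (marr a x)) ->
  lin_comp (marr b) f = lin_comp g (marr a).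
Proof. by move=> fg; exact: linear_eq. Qed.

Definition mkmor a b (f : {linear msrc a -> msrc b})
    (g : {linear mtgt a -> mtgt b}) fg : morhom a b :=
  MorHom (@mkmor_sq a b f g fg).

Lemma morhom_ext a b (f g : morhom a b) :
  (forall x, fsrc f x = fsrc g x) -> (forall y, ftgt f y = ftgt g y) -> f = g.
Proof. by move=> e1 e2; apply: morhom_eq; exact: linear_eq. Qed.

Lemma fsrc_congr a b (f g : morhom a b) :
  f = g -> forall x, fsrc f x = fsrc g x.
Proof. by move=> ->. Qed.

Lemma ftgt_congr a b (f g : morhom a b) :
  f = g -> forall x, ftgt f x = ftgt g x.
Proof. by move=> ->. Qed.

(** These objects represent the components of a morphism: [mor_idm] is left adjoint to the source
    functor and right adjoint to the target functor, [mor_from0] is left adjoint to the target and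
    [mor_to0] right adjoint to the source. Morphisms into [mor_from0 M] are maps from the cokernel
    to [M]. *)
Definition mor_idm M : morob R := MorOb (lin_id M).
Definition mor_from0 M : morob R := MorOb (lin_zero zmod M).
Definition mor_to0 M : morob R := MorOb (lin_zero M zmod).

Definition from_idm M a (f : {linear M -> msrc a}) : morhom (mor_idm M) a :=
  @mkmor (mor_idm M) a f (lin_comp (marr a) f) (fun=> erefl).

Fact from_from0_sq M a (f : {linear M -> mtgt a}) x :
  marr a (lin_zero zmod (msrc a) x) = f (marr (mor_from0 M) x).
Proof. by rewrite /= !linear0. Qed.
Definition from_from0 M a (f : {linear M -> mtgt a}) : morhom (mor_from0 M) a :=
  @mkmor (mor_from0 M) a (lin_zero _ _) f (from_from0_sq f).

Definition to_idm M a (f : {linear mtgt a -> M}) : morhom a (mor_idm M) :=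
  @mkmor a (mor_idm M) (lin_comp f (marr a)) f (fun=> erefl).

Definition to_from0 M a (f : {linear mtgt a -> M})
    (f0 : forall x, f (marr a x) = 0) :
    morhom a (mor_from0 M) :=
  @mkmor a (mor_from0 M) (lin_zero _ _) f (fun x => esym (f0 x)).

Fact to_to0_sq M a (f : {linear msrc a -> M}) x :
  marr (mor_to0 M) (f x) = lin_zero (mtgt a) zmod (marr a x).
Proof. by []. Qed.
Definition to_to0 M a (f : {linear msrc a -> M}) : morhom a (mor_to0 M) :=
  @mkmor a (mor_to0 M) f (lin_zero _ _) (to_to0_sq f).

(** Morphisms into [mor_to0 M] test the source component, those into [mor_idm M] the target
    component. *)
Lemma mor_epiP a b (f : morhom a b) :
  is_epi (f : hom_set (a : Mor R) b) <-> surj (fsrc f) /\ surj (ftgt f).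
Proof.
split=> [epi_f|[s1 s2] c u v uv].
  split; apply/mod_epiP => M u v /lin_congr uv.
    suff /fsrc_congr uv' : to_to0 u = to_to0 v by exact: linear_eq.
    by apply: epi_f; apply: morhom_ext.
  suff /ftgt_congr uv' : to_idm u = to_idm v by exact: linear_eq.
  apply: epi_f; apply: morhom_ext => //= x.
  by rewrite morE; exact: uv.
apply: morhom_ext => y.
  by have [x <-] := s1 y; exact: (fsrc_congr uv x).
by have [x <-] := s2 y; exact: (ftgt_congr uv x).
Qed.

(** The universal property is tested on [mor_idm M] for the source and [mor_from0 M] for the target.
    Conversely, the componentwise factorizations form a square because [ftgt i] is injective. *)
Lemma mor_kernelP k a b (f : morhom a b) (i : morhom k a) :
  is_kernel (f : hom_set (a : Mor R) b) (i : hom_set (k : Mor R) a) <->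
  is_kernel (fsrc f : hom_set (msrc a : Mod R) _)
            (fsrc i : hom_set (_ : Mod R) _) /\
  is_kernel (ftgt f : hom_set (mtgt a : Mod R) _)
            (ftgt i : hom_set (_ : Mod R) _).
Proof.
split=> [[fi0 univ]|[/mod_kernelP[inj1 fi1 ker1] /mod_kernelP[inj2 fi2 ker2]]].
  split; split.
  - by apply: linear_eq => x; exact: (fsrc_congr fi0 x).
  - move=> M u /lin_congr fu0.
    have [|v [iv uv]] := univ _ (from_idm u).
      apply: morhom_ext => [|x]; first exact: fu0.
      by rewrite /= -morE; have /= -> := fu0 x; rewrite linear0.
    exists (fsrc v); split=> [|w iw].
      by apply: linear_eq => x; exact: (fsrc_congr iv x).
    apply: linear_eq => x.
    suff /fsrc_congr -> : v = from_idm w by [].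
    apply: uv; apply: morhom_ext => /= y; first exact: (lin_congr iw y).
    by rewrite -morE; have /= -> := lin_congr iw y.
  - by apply: linear_eq => x; exact: (ftgt_congr fi0 x).
  - move=> M u /lin_congr fu0.
    have [|v [iv uv]] := univ _ (from_from0 u).
      apply: morhom_ext => [x|]; last exact: fu0.
      by rewrite /= linear0.
    exists (ftgt v); split=> [|w iw].
      by apply: linear_eq => x; exact: (ftgt_congr iv x).
    apply: linear_eq => x.
    suff /ftgt_congr -> : v = from_from0 w by [].
    apply: uv; apply: morhom_ext => /= y; first by rewrite linear0.
    exact: (lin_congr iw y).
split=> [|c u fu0].
  by apply: morhom_ext => x; [exact: fi1 | exact: fi2].
have [v1 v1E] := factor_inj inj1 (fun x => ker1 _ (fsrc_congr fu0 x)).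
have [v2 v2E] := factor_inj inj2 (fun x => ker2 _ (ftgt_congr fu0 x)).
have v12 x : marr k (v1 x) = v2 (marr c x).
  by apply: inj2; rewrite -morE v1E v2E morE.
exists (@mkmor c k _ _ v12); split=> [|w iw]; first exact: morhom_ext.
apply: morhom_ext => x /=.
  by apply: inj1; rewrite v1E -(fsrc_congr iw x).
by apply: inj2; rewrite v2E -(ftgt_congr iw x).
Qed.

(** The images of the two components form an object of [Mor], since the arrow of [b] restricts to
    them; it provides the required factorization. *)
Lemma mor_exactP a b c (f : morhom a b) (g : morhom b c) :
  exact_at (f : hom_set (a : Mor R) b) (g : hom_set (b : Mor R) c) <->
  exact_lin (fsrc f) (fsrc g) /\ exact_lin (ftgt f) (ftgt g).
Proof.
split=> [[k [i [e [/mor_kernelP[k1 k2] /mor_epiP[e1 e2] ->]]]]|].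
  by split; apply/mod_exactP; [exists (msrc k), (fsrc i), (fsrc e) |
     exists (mtgt k), (ftgt i), (ftgt e)]; split=> //; exact/mod_epiP.
case=> -[gf1 ker1] [gf2 ker2].
have [K1 [p1 [i1 [s1 inj1 ip1]]]] := image_exists (fsrc f).
have [K2 [p2 [i2 [s2 inj2 ip2]]]] := image_exists (ftgt f).
have [|m mE] := factor_inj (u := lin_comp (marr b) i1) inj2.
  move=> y; have [x <-] := s1 y; exists (p2 (marr a x)).
  by rewrite ip2 -morE /= ip1.
pose k := MorOb m.
have sqp x : marr k (p1 x) = p2 (marr a x).
  by apply: inj2; rewrite mE /= ip1 ip2 morE.
exists k, (@mkmor k b i1 i2 (fun x => esym (mE x))), (@mkmor a k p1 p2 sqp).
split; last by apply: morhom_ext => x /=.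
  apply/mor_kernelP; split; apply/mod_kernelP; split=> //=.
  - by move=> x; have [y <-] := s1 x; rewrite ip1.
  - by move=> y /ker1[x <-]; exists (p1 x).
  - by move=> x; have [y <-] := s2 x; rewrite ip2.
  - by move=> y /ker2[x <-]; exists (p2 x).
exact/mor_epiP.
Qed.

Lemma mor_projectiveP a : projective_object (a : Mor R) <->
  [/\ projective_object (msrc a : Mod R), projective_object (mtgt a : Mod R) &
      exists r : {linear mtgt a -> msrc a}, cancel (marr a) r].
Proof.
split=> [proja|[/mod_projectiveP proj1 /mod_projectiveP proj2 [r rK]]].
  have [r rK] : exists r : {linear mtgt a -> msrc a}, cancel (marr a) r.
    (* The inclusion of the source into source plus target maps onto [a]. The target component of a
       section, followed by the first projection, retracts [marr a]. *)
    pose c := MorOb (lin_inl (msrc a) (mtgt a)).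
    have sq x : marr a (lin_id _ x) = lin_copair (marr a) (lin_id _) (marr c x).
      by rewrite /= addr0.
    have epi_e : is_epi (@mkmor c a _ _ sq : hom_set (c : Mor R) a).
      apply/mor_epiP; split=> [x|y]; first by exists x.
      by exists (0, y); rewrite /= linear0 add0r.
    have [s es] := proja _ _ _ epi_e (mor_id a).
    exists (lin_comp (lin_fst _ _) (ftgt s)) => x /=.
    by rewrite -morE /=; exact: (fsrc_congr es x).
  have proj2 : projective_object (mtgt a : Mod R).
    apply/mod_projectiveP => A B e e_surj f.
    have epi_e : is_epi (@mkmor (mor_idm A) (mor_idm B) e e (fun=> erefl)
                         : hom_set (mor_idm A : Mor R) (mor_idm B)).
      exact/mor_epiP.
    have [g eg] := proja _ _ _ epi_e (to_idm f).
    by exists (ftgt g) => x; exact: (ftgt_congr eg x).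
  split=> //; last by exists r.
  (* The source is a retract of the projective target. *)
  apply/mod_projectiveP => A B e e_surj f.
  move/mod_projectiveP: proj2 => proj2.
  have [g gE] := proj2 _ _ _ e_surj (lin_comp f r).
  by exists (lin_comp g (marr a)) => x; rewrite /= gE /= rK.
move=> b c e /mor_epiP[s1 s2] f.
have [g1 g1E] := proj1 _ _ _ s1 (fsrc f).
have [g2 g2E] := proj2 _ _ _ s2 (ftgt f).
(* The target of [a] splits as the image of [marr a] plus the kernel of [r]. The lift must extend
   [g1] on the first summand, and is free to be [g2] on the second. *)
pose g := lin_add (lin_comp (marr b) (lin_comp g1 r))
                  (lin_comp g2 (lin_sub (lin_id _) (lin_comp (marr a) r))).
have sq x : marr b (g1 x) = g (marr a x) by rewrite /= rK subrr linear0 addr0.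
exists (@mkmor a b _ _ sq); apply: morhom_ext => x; first exact: g1E.
rewrite /= linearD -morE g1E g2E linearB /= morE.
by rewrite addrC subrK.
Qed.

End Morphisms.

(** * Elementwise descriptions of total acyclicity *)

Section TotallyAcyclic.
Variable R : comPzRingType.
Implicit Types (M F : lmodType R) (X : complex (Mod R)) (Y : complex (Mor R)).

Definition hom_exact X F := forall i j k, j = i + 1 -> k = j + 1 ->
  forall g : {linear cterm X j -> F}, (forall x, g (cdiff X i j x) = 0) ->
  exists h : {linear cterm X k -> F}, forall x, h (cdiff X j k x) = g x.

Definition exact_seq X := forall i j k, j = i + 1 -> k = j + 1 ->
  exact_lin (cdiff X i j) (cdiff X j k).

Lemma mod_totally_acyclicP X : totally_acyclic X <->
  [/\ forall i, projective_object (cterm X i : Mod R), exact_seq X &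
      forall F, projective_object (F : Mod R) -> hom_exact X F].
Proof.
split=> -[projX eX homX]; split=> //.
- move=> i j k ij jk; apply/mod_exactP.
  exact: (exact_complexP X).1 eX i j k ij jk.
- move=> F projF i j k ij jk g g0.
  have [|h hE] := (exact_hom_intoP X F).1 (homX F projF) i j k ij jk g.
    exact: linear_eq.
  by exists h => x; rewrite hE.
- apply/exact_complexP => i j k ij jk.
  by apply/(mod_exactP (cdiff X i j) (cdiff X j k)); exact: eX.
- move=> F projF; apply/exact_hom_intoP => i j k ij jk g /lin_congr g0.
  have [h hE] := homX F projF i j k ij jk g g0.
  by exists h; apply: linear_eq => x; rewrite /= -hE.
Qed.

Lemma cdiff_cdiff X i j k x : cdiff X j k (cdiff X i j x) = 0.
Proof. exact: (lin_congr (cd_cd X i j k) x). Qed.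

Definition mterm Y i : morob R := Y i.
Definition mdiff Y i j : morhom (mterm Y i) (mterm Y j) := cd Y i j.

Definition mor_hom_exact Y (a : morob R) :=
  forall i j k, j = i + 1 -> k = j + 1 ->
  forall g : morhom (mterm Y j) a,
  (forall x, fsrc g (fsrc (mdiff Y i j) x) = 0) ->
  (forall x, ftgt g (ftgt (mdiff Y i j) x) = 0) ->
  exists h : morhom (mterm Y k) a,
    (forall x, fsrc h (fsrc (mdiff Y j k) x) = fsrc g x) /\
    (forall x, ftgt h (ftgt (mdiff Y j k) x) = ftgt g x).

Definition mor_exact_seq Y := forall i j k, j = i + 1 -> k = j + 1 ->
  exact_lin (fsrc (mdiff Y i j)) (fsrc (mdiff Y j k)) /\
  exact_lin (ftgt (mdiff Y i j)) (ftgt (mdiff Y j k)).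

Lemma mor_totally_acyclicP Y : totally_acyclic Y <->
  [/\ forall i, projective_object (mterm Y i : Mor R), mor_exact_seq Y &
      forall a, projective_object (a : Mor R) -> mor_hom_exact Y a].
Proof.
split=> -[projY eY homY]; split=> //.
- move=> i j k ij jk; apply/mor_exactP.
  exact: (exact_complexP Y).1 eY i j k ij jk.
- move=> a proja i j k ij jk g g1 g2.
  have [|h hE] := (exact_hom_intoP Y a).1 (homY a proja) i j k ij jk g.
    exact: morhom_ext.
  by exists h; rewrite hE.
- apply/exact_complexP => i j k ij jk.
  by apply/(mor_exactP (mdiff Y i j) (mdiff Y j k)); exact: eY.
- move=> a proja; apply/exact_hom_intoP => i j k ij jk g g0.
  have [h [h1 h2]] := homY a proja i j k ij jk g
    (fsrc_congr g0) (ftgt_congr g0).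
  by exists h; apply: morhom_ext => x; rewrite /= -?h1 -?h2.
Qed.

Lemma mod_gorenstein_projectiveP M : gorenstein_projective (M : Mod R) <->
  forall n, exists X, totally_acyclic X /\
  exists k : {linear M -> cterm X n},
    injective k /\ exact_lin k (cdiff X n (n + 1)).
Proof.
split=> [gpM n|/(_ 0)[X [taX [k [k_inj [dk ker]]]]]].
  have [X [taX [k kerk]]] := gorenstein_projective_at n gpM.
  exists X; split=> //; exists k.
  by have [] := (mod_kernelP (cdiff X n (n + 1)) k).1 kerk.
by exists X; split=> //; exists 0, k; exact/(mod_kernelP (cdiff X 0 (0 + 1)) k).
Qed.

End TotallyAcyclic.

(** * Source, target and cokernel of a totally acyclic complex in [Mor] *)

Section Cokernel.
Variable R : comPzRingType.
Implicit Types (F : lmodType R) (a b c : morob R).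

(** One cokernel is chosen for each object, so that cokernels can be assembled into a complex. *)
Definition coker_mod a : lmodType R := sval (cid (coker_exists (marr a))).
Definition coker_proj a : {linear mtgt a -> coker_mod a} :=
  sval (cid (svalP (cid (coker_exists (marr a))))).

Lemma coker_proj_surj a : surj (coker_proj a).
Proof. by have [] := svalP (cid (svalP (cid (coker_exists (marr a))))). Qed.

Lemma coker_proj_eq0 a y : coker_proj a y = 0 <-> exists x, marr a x = y.
Proof.
exact: (svalP (cid (svalP (cid (coker_exists (marr a)))))).2.
Qed.

Lemma coker_proj_arr a x : coker_proj a (marr a x) = 0.
Proof. by apply/coker_proj_eq0; exists x. Qed.

Lemma coker_map_exists a b (f : morhom a b) :
  exists g : {linear coker_mod a -> coker_mod b},
  forall y, g (coker_proj a y) = coker_proj b (ftgt f y).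
Proof.
apply: (factor_surj (f := lin_comp (coker_proj b) (ftgt f))).
  exact: coker_proj_surj.
by move=> y /coker_proj_eq0[x <-]; rewrite /= -morE coker_proj_arr.
Qed.

Definition coker_map a b (f : morhom a b) := sval (cid (coker_map_exists f)).

Lemma coker_mapE a b (f : morhom a b) y :
  coker_map f (coker_proj a y) = coker_proj b (ftgt f y).
Proof. exact: (svalP (cid (coker_map_exists f))). Qed.

(** The cokernel is a direct summand of the target: [1 - marr a \o r] kills the image of [marr a].
    Hence a lift defined on the target descends after composition with this idempotent. *)
Lemma coker_projective a :
  projective_object (a : Mor R) -> projective_object (coker_mod a : Mod R).
Proof.
case/mor_projectiveP=> _ /mod_projectiveP projT [r rK].
apply/mod_projectiveP => A B e e_surj f.
have [g gE] := projT _ _ _ e_surj (lin_comp f (coker_proj a)).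
have [|h hE] := factor_surj (@coker_proj_surj a)
    (f := lin_sub g (lin_comp g (lin_comp (marr a) r))).
  by move=> y /coker_proj_eq0[x <-]; rewrite /= rK subrr.
exists h => z; have [y <-] := coker_proj_surj z.
by rewrite hE /= linearB !gE /= coker_proj_arr linear0 subr0.
Qed.

Variable X : complex (Mor R).
Local Notation d := (mdiff X).

Definition src_complex : complex (Mod R).
Proof.
refine (@Complex (Mod R) (fun i => msrc (mterm X i))
  (fun i j => fsrc (d i j)) _ _).
- move=> i j ij; apply: linear_eq => x.
  exact: (fsrc_congr (cd_shape X ij) x).
- by move=> i j k; apply: linear_eq => x; exact: (fsrc_congr (cd_cd X i j k) x).
Defined.

Definition tgt_complex : complex (Mod R).
Proof.
refine (@Complex (Mod R) (fun i => mtgt (mterm X i))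
  (fun i j => ftgt (d i j)) _ _).
- move=> i j ij; apply: linear_eq => x.
  exact: (ftgt_congr (cd_shape X ij) x).
- by move=> i j k; apply: linear_eq => x; exact: (ftgt_congr (cd_cd X i j k) x).
Defined.

Definition coker_complex : complex (Mod R).
Proof.
refine (@Complex (Mod R) (fun i => coker_mod (mterm X i))
  (fun i j => coker_map (d i j)) _ _).
- move=> i j ij; apply: linear_eq => z; have [y <-] := coker_proj_surj z.
  rewrite coker_mapE /=.
  by have /= -> := ftgt_congr (cd_shape X ij) y; rewrite linear0.
- move=> i j k; apply: linear_eq => z; have [y <-] := coker_proj_surj z.
  rewrite /= !coker_mapE.
  by have /= -> := ftgt_congr (cd_cd X i j k) y; rewrite linear0.
Defined.

Hypothesis taX : totally_acyclic X.

Let projX i : projective_object (mterm X i : Mor R).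
Proof. by have /mor_totally_acyclicP[] := taX. Qed.

Let homX a : projective_object (a : Mor R) -> mor_hom_exact X a.
Proof. by have /mor_totally_acyclicP[_ _ homX] := taX; exact: homX. Qed.

Let exactX : mor_exact_seq X.
Proof. by have /mor_totally_acyclicP[] := taX. Qed.

Lemma totally_acyclic_arr_inj i : injective (marr (mterm X i)).
Proof. by have /mor_projectiveP[_ _ [r /can_inj]] := @projX i. Qed.

(** Maps from the target to [F] are morphisms into [mor_idm F], which is projective when [F] is. *)
Lemma tgt_totally_acyclic : totally_acyclic tgt_complex.
Proof.
apply/mod_totally_acyclicP; split=> [i|i j k ij jk|F projF i j k ij jk g g0].
- by have /mor_projectiveP[] := @projX i.
- by have [] := exactX ij jk.
have projI : projective_object (mor_idm F : Mor R).
  by apply/mor_projectiveP; split=> //; exists (lin_id F).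
have [|x|h [_ hE]] := @homX _ projI i j k ij jk (to_idm g).
- by move=> x; rewrite /= morE; exact: g0.
- exact: g0.
by exists (ftgt h).
Qed.

(* Exactness of Hom(X, 0 -> F). *)
Lemma hom_from0_exact F i j k (v : {linear mtgt (mterm X j) -> F}) :
  projective_object (F : Mod R) -> j = i + 1 -> k = j + 1 ->
  (forall x, v (marr _ x) = 0) -> (forall y, v (ftgt (d i j) y) = 0) ->
  exists w : {linear mtgt (mterm X k) -> F},
    (forall x, w (marr _ x) = 0) /\ forall y, w (ftgt (d j k) y) = v y.
Proof.
move=> projF ij jk v0 vd.
have proj0 : projective_object (mor_from0 F : Mor R).
  apply/mor_projectiveP; split=> //.
    apply/mod_projectiveP => A B e _ f; exists (lin_zero _ _) => x.
    by rewrite (zmod0 x) !linear0.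
  by exists (lin_zero _ _) => x; rewrite (zmod0 x) linear0.
have [//|//|h [_ hE]] := @homX _ proj0 i j k ij jk (to_from0 v0).
exists (ftgt h); split=> // x.
by rewrite -morE.
Qed.

(** Exactness is a chase through the exact source and target complexes. For exactness of Hom into
    [F], a map from the cokernel is treated as a map from the target that vanishes on the source. *)
Lemma coker_totally_acyclic : totally_acyclic coker_complex.
Proof.
apply/mod_totally_acyclicP; split=> [i|i j k ij jk|F projF i j k ij jk g g0].
- exact: coker_projective.
- have [_ [_ kerT]] := exactX ij jk.
  have [[_ kerP] [dd0 _]] := exactX jk erefl.
  split=> [z|z]; first exact: cdiff_cdiff.
  have [y <-] := coker_proj_surj z.
  rewrite [LHS]coker_mapE => /coker_proj_eq0[x xE].
  have dx0 : fsrc (d k (k + 1)) x = 0.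
    by apply: (@totally_acyclic_arr_inj (k + 1)); rewrite linear0 morE xE dd0.
  (* Since [x] is a boundary [d w], subtracting the image of [w] from [y] gives a cycle of the
     target with the same class in the cokernel. *)
  have [w wE] := kerP x dx0.
  have [|t tE] := kerT (y - marr _ w).
    by rewrite linearB -morE wE xE subrr.
  exists (coker_proj _ t).
  by rewrite [LHS]coker_mapE tE linearB coker_proj_arr subr0.
have [x|y|w [w0 wE]] := hom_from0_exact (v := lin_comp g (coker_proj _))
    projF ij jk.
- by rewrite /= coker_proj_arr linear0.
- by rewrite /= -coker_mapE; exact: g0.
have [|h hE] := factor_surj (@coker_proj_surj (mterm X k)) (f := w).
  by move=> y /coker_proj_eq0[x <-].
exists h => z; have [y <-] := coker_proj_surj z.
by rewrite [cdiff _ _ _ _]coker_mapE hE wE.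
Qed.

(** A cocycle on the source extends along the retraction to the target and is corrected there to a
    cocycle with the same restriction. Total acyclicity of the target complex then applies, and its
    solution is restricted back to the source. *)
Lemma src_totally_acyclic : totally_acyclic src_complex.
Proof.
apply/mod_totally_acyclicP; split=> [i|i j k ij jk|F projF i j k ij jk g g0].
- by have /mor_projectiveP[] := @projX i.
- by have [] := exactX ij jk.
have {}g0 x : g (fsrc (d i j) x) = 0 := g0 x.
have /mor_projectiveP[_ _ [r rK]] := @projX j.
pose gr := lin_comp g r.
have li : i = i - 1 + 1 by rewrite subrK.
(* g r is an extension of g to the target, but not a cocycle; its coboundary
   vanishes on the source, and subtracting w corrects it. *)
have [x|y|w [w0 wE]] := hom_from0_exact (v := lin_comp gr (ftgt (d i j)))
    projF li ij.
- by rewrite /= -morE rK g0.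
- by have [_ [/= -> _]] := exactX li ij; rewrite !linear0.
have [_ _ homT] := (mod_totally_acyclicP tgt_complex).1 tgt_totally_acyclic.
have [y|h hE] := homT F projF i j k ij jk (lin_sub gr w).
  by rewrite /= wE subrr.
exists (lin_comp h (marr _)) => x.
by rewrite /= morE [LHS]hE /= rK w0 subr0.
Qed.

End Cokernel.

(** * Extensions of complexes twisted by a map of degree 1 *)

Section Extension.
Variable R : comPzRingType.
Implicit Types F : lmodType R.
Variables (P Q : complex (Mod R)).
Variable sigma : forall i j, {linear cterm Q i -> cterm P j}.
Hypothesis sigma_shape :
  forall i j : int, j != i + 1 -> forall z, sigma i j z = 0.
Hypothesis sigma_anti : forall i j k z,
  cdiff P j k (sigma i j z) + sigma j k (cdiff Q i j z) = 0.

Definition ext_term i : morob R := MorOb (lin_inl (cterm P i) (cterm Q i)).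

(** Up to shift and sign this is the differential of the mapping cone of [sigma]; [sigma_anti] is
    the vanishing of the off-diagonal entry of its square. *)
Definition ext_diff i j : {linear mtgt (ext_term i) -> mtgt (ext_term j)} :=
  lin_pair (lin_copair (cdiff P i j) (sigma i j))
           (lin_comp (cdiff Q i j) (lin_snd _ _)).

Fact ext_sq i j x :
  marr (ext_term j) (cdiff P i j x) = ext_diff i j (marr (ext_term i) x).
Proof. by rewrite /= !linear0 addr0. Qed.

Definition ext_mor i j : morhom (ext_term i) (ext_term j) :=
  @mkmor R (ext_term i) (ext_term j) (cdiff P i j) (ext_diff i j) (@ext_sq i j).

Lemma ext_diff_diff i j k z : ext_diff j k (ext_diff i j z) = 0.
Proof.
rewrite /= linearD !cdiff_cdiff add0r /=.
by rewrite sigma_anti.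
Qed.

Definition ext_complex : complex (Mor R).
Proof.
refine (@Complex (Mor R) ext_term ext_mor _ _).
- move=> i j ij; apply: morhom_ext => x.
    exact: (lin_congr (cd_shape P ij) x).
  rewrite /= sigma_shape // addr0; congr pair.
    exact: (lin_congr (cd_shape P ij) x.1).
  exact: (lin_congr (cd_shape Q ij) x.2).
- move=> i j k; apply: morhom_ext => x; first exact: cdiff_cdiff.
  exact: ext_diff_diff.
Defined.

Hypotheses (taP : totally_acyclic P) (taQ : totally_acyclic Q).

Lemma ext_exact i j k : j = i + 1 -> k = j + 1 ->
  exact_lin (ext_diff i j) (ext_diff j k).
Proof.
have /mod_totally_acyclicP[_ exP _] := taP.
have /mod_totally_acyclicP[_ exQ _] := taQ.
move=> ij jk; split=> [z|[p z] [pz0 z0]]; first exact: ext_diff_diff.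
have [y yz] := (exQ i j k ij jk).2 z z0.
(* Once [y] bounds [z] in [Q], the anticommutation turns the cycle condition on [(p, z)] into
   [p - sigma y] being a cycle of [P]. *)
have [|w wE] := (exP i j k ij jk).2 (p - sigma i j y).
  rewrite linearB /=; move: (@sigma_anti i j k y) => /eqP.
  by rewrite addr_eq0 yz => /eqP ->; rewrite opprK.
by exists (w, y); rewrite /= wE yz subrK.
Qed.

Lemma ext_hom_exact F i j k (g : {linear mtgt (ext_term j) -> F}) :
  projective_object (F : Mod R) -> j = i + 1 -> k = j + 1 ->
  (forall x, g (ext_diff i j x) = 0) ->
  exists h : {linear mtgt (ext_term k) -> F},
    forall x, h (ext_diff j k x) = g x.
Proof.
have /mod_totally_acyclicP[_ _ homP] := taP.
have /mod_totally_acyclicP[_ _ homQ] := taQ.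
move=> projF ij jk g0.
have g0P x : g (cdiff P i j x, 0) = 0.
  by rewrite -[RHS](g0 (x, 0)) /= !linear0 addr0.
have g0Q z : g (sigma i j z, cdiff Q i j z) = 0.
  by rewrite -[RHS](g0 (0, z)) /= linear0 add0r.
have [h1 h1E] := homP F projF i j k ij jk (lin_comp g (lin_inl _ _)) g0P.
(* After the restriction of [g] to [P] is extended by [h1], the part left to extend on [Q] is [g]
   minus [h1 \o sigma]; anticommutation makes it a cocycle. *)
pose u : {linear cterm Q j -> F} :=
  lin_sub (lin_comp g (lin_inr _ _)) (lin_comp h1 (sigma j k)).
have [z|h2 h2E] := homQ F projF i j k ij jk u.
  move: (@sigma_anti i j k z) => /eqP; rewrite addrC addr_eq0 => /eqP e.
  rewrite /= e linearN opprK h1E /= -linearD -[RHS](g0Q z).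
  by congr (g (_, _)); rewrite /= ?add0r ?addr0.
exists (lin_copair h1 h2) => -[p z].
rewrite /= linearD h1E h2E /= -addrA [h1 _ + _]addrC subrK -linearD.
by congr (g (_, _)); rewrite /= ?add0r ?addr0.
Qed.

Lemma ext_totally_acyclic : totally_acyclic ext_complex.
Proof.
have /mod_totally_acyclicP[projP exP _] := taP.
have /mod_totally_acyclicP[projQ _ homQ] := taQ.
apply/mor_totally_acyclicP; split=> [i|i j k ij jk|a].
- apply/mor_projectiveP; split; first exact: projP.
    apply/mod_projectiveP => A B e e_surj f.
    have /mod_projectiveP/(_ _ _ _ e_surj)liftP := projP i.
    have /mod_projectiveP/(_ _ _ _ e_surj)liftQ := projQ i.
    have [g1 g1E] := liftP (lin_comp f (lin_inl _ _)).
    have [g2 g2E] := liftQ (lin_comp f (lin_inr _ _)).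
    exists (lin_copair g1 g2) => -[p z].
    rewrite /= linearD g1E g2E /= -linearD.
    by congr (f (_, _)); rewrite /= ?add0r ?addr0.
  by exists (lin_fst _ _).
- by split; [exact: exP | exact: ext_exact].
case/mor_projectiveP=> projF projG [r rK] i j k ij jk g g1 g2.
(* The target of [a] splits along [r]: [h1] handles the component of [g] in the image of [marr a],
   and [h2] below the complementary one. *)
have [x|h1 h1E] := @ext_hom_exact _ i j k (lin_comp r (ftgt g)) projF ij jk.
  by have /= -> := g2 x; rewrite linear0.
have gP p : ftgt g (p, 0) = marr a (fsrc g p) by rewrite morE.
have gD p z : ftgt g (p, z) = ftgt g (p, 0) + ftgt g (0, z).
  by rewrite -linearD; congr (ftgt g (_, _)); rewrite /= ?add0r ?addr0.
pose g' : {linear cterm Q j -> mtgt a} := lin_comp (ftgt g) (lin_inr _ _).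
(* On [P], [g] takes values in the image of [marr a], so its complementary component depends on [Q]
   only and is a cocycle there. *)
have [z|h2 h2E] := homQ _ projG i j k ij jk
    (lin_sub g' (lin_comp (marr a) (lin_comp r g'))).
  have := g2 (0, z); rewrite /= linear0 add0r gD => /eqP.
  rewrite addrC addr_eq0 => /eqP ->.
  by rewrite gP !linearN /= rK subrr.
pose hT : {linear mtgt (ext_term k) -> mtgt a} :=
  lin_add (lin_comp (marr a) h1) (lin_comp h2 (lin_snd _ _)).
have sq x : marr a (lin_comp h1 (lin_inl _ _) x) = hT (marr (ext_term k) x).
  by rewrite /= linear0 addr0.
exists (@mkmor _ (ext_term k) a _ _ sq); split=> [x|[p z]] /=.
  have := h1E (x, 0); rewrite /= !linear0 addr0 => ->.
  by rewrite gP rK.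
have := h1E (p, z) => /= ->.
rewrite h2E /= gD gP !linearD /= rK -addrA; congr (_ + _).
by rewrite addrC subrK.
Qed.

End Extension.

(** * Passing between cycle objects in [Mor] and their source, target and cokernel *)

Section Correspondence.
Variable R : comPzRingType.

(* The condition d s_i d = 0 is what allows extending s_i both to the right, as
   Hom(Q, P (i + 2)) is exact, and to the left, as Q (i - 1) is projective; both
   steps preserve it. *)
Lemma anti_chain_map_exists (P Q : complex (Mod R))
    (s0 : {linear cterm Q 0 -> cterm P 1}) :
  totally_acyclic P -> totally_acyclic Q ->
  (forall x, cdiff P 1 2 (s0 (cdiff Q (-1) 0 x)) = 0) ->
  exists sigma : forall i j, {linear cterm Q i -> cterm P j},
    [/\ forall x, sigma 0 1 x = s0 x,
        forall i j, j != i + 1 -> forall z, sigma i j z = 0 &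
        forall i j k z,
          cdiff P j k (sigma i j z) + sigma j k (cdiff Q i j z) = 0].
Proof.
move=> /mod_totally_acyclicP[projP exP _].
move=> /mod_totally_acyclicP[projQ _ homQ] s00.
pose T i := {f : {linear cterm Q i -> cterm P (i + 1)} |
  forall h, i = h + 1 ->
  forall x, cdiff P (i + 1) (i + 1 + 1) (f (cdiff Q h i x)) = 0}.
pose rel i j (f : T i) (g : T j) := forall x,
  cdiff P (i + 1) (j + 1) (sval f x) = - sval g (cdiff Q i j x).
have T0P h : 0 = h + 1 -> forall x,
    cdiff P (0 + 1) (0 + 1 + 1) (s0 (cdiff Q h 0 x)) = 0.
  by move=> h0; have -> : h = -1 by lia.
have [i j [f f0] ij|i j [g g0] ij|s [s0E sE]] :=
    int_dependent_choice (rel := rel) (exist _ s0 T0P : T 0).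
- subst j.
  pose u : {linear cterm Q i -> cterm P (i + 1 + 1)} :=
    lin_sub (lin_zero _ _) (lin_comp (cdiff P (i + 1) (i + 1 + 1)) f).
  have li : i = i - 1 + 1 by rewrite subrK.
  (* The invariant on [f] says that [u = - d f] is a cocycle on [Q], so it extends along the
     differential into the projective term of [P]. *)
  have [x|g gE] := homQ _ (projP _) (i - 1) i (i + 1) li erefl u.
    by rewrite /= f0 // subrr.
  have g0 h : i + 1 = h + 1 -> forall x,
      cdiff P (i + 1 + 1) (i + 1 + 1 + 1) (g (cdiff Q h (i + 1) x)) = 0.
    move=> /addIr <- x; rewrite gE /= sub0r linearN.
    by rewrite cdiff_cdiff oppr0.
  by exists (exist _ g g0) => x; rewrite /= gE /= sub0r opprK.
- subst j.
  pose u : {linear cterm Q i -> cterm P (i + 1 + 1)} :=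
    lin_sub (lin_zero _ _) (lin_comp g (cdiff Q i (i + 1))).
  (* The invariant on [g] says that [u = - g d] lands in the cycles of [P], so it lifts from the
     projective term of [Q]. *)
  have [x|f fE] := projective_lift (projQ i)
      (exP (i + 1) (i + 1 + 1) (i + 1 + 1 + 1) erefl erefl) (u := u).
    by rewrite /= sub0r linearN g0 // oppr0.
  have f0 h : i = h + 1 -> forall x,
      cdiff P (i + 1) (i + 1 + 1) (f (cdiff Q h i x)) = 0.
    by move=> _ x; rewrite fE /= cdiff_cdiff linear0 subr0.
  by exists (exist _ f f0) => x; rewrite /= fE /= sub0r.
pose sigma i j : {linear cterm Q i -> cterm P j} :=
  extend_by_zero (C := Mod R) (X := P) (m := i + 1) (sval (s i)) j.
have sigmaE i x : sigma i (i + 1) x = sval (s i) x.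
  by rewrite /sigma extend_by_zeroE.
have sigma0 i j : j != i + 1 -> forall z, sigma i j z = 0.
  by move=> ij z; rewrite /sigma extend_by_zero_neq.
have cd0 (X : complex (Mod R)) i j :
    j != i + 1 -> forall z : cterm X i, cdiff X i j z = 0.
  by move=> ij z; exact: (lin_congr (cd_shape X ij) z).
exists sigma; split=> // [x|i j k z].
  by have := sigmaE 0 x; rewrite s0E.
(* Away from consecutive degrees both summands vanish by shape. *)
have [->|ij] := eqVneq j (i + 1); last first.
  by rewrite (sigma0 _ _ ij) (cd0 Q _ _ ij) !linear0 addr0.
have [->|jk] := eqVneq k (i + 1 + 1); last first.
  by rewrite (sigma0 _ _ jk) (cd0 P _ _ jk) addr0.
by rewrite !sigmaE sE // addNr.
Qed.

(** Kernels in [Mor] are componentwise, which settles source and target. For the cokernel, the exact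
    source complex ensures that taking cycles preserves the short exact sequence. *)
Lemma gorenstein_projective_parts (alpha : Mor R) :
  gorenstein_projective alpha ->
  [/\ injective (marr alpha),
      gorenstein_projective (msrc alpha : Mod R),
      gorenstein_projective (mtgt alpha : Mod R) &
      gorenstein_projective (coker_mod alpha : Mod R)].
Proof.
case=> X [taX [n [k /mor_kernelP[ker1 ker2]]]].
have [inj1 dk1 kerk1] := (mod_kernelP _ _).1 ker1.
have [inj2 dk2 kerk2] := (mod_kernelP _ _).1 ker2.
have injX := totally_acyclic_arr_inj taX.
have inja : injective (marr alpha).
  apply: lin_injP => x ax0; apply: inj1; apply: (injX n).
  by rewrite morE ax0 !linear0.
have /mod_totally_acyclicP[_ exP _] := src_totally_acyclic taX.
split=> //.
- exists (src_complex X); split; first exact: src_totally_acyclic.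
  by exists n, (fsrc k).
- exists (tgt_complex X); split; first exact: tgt_totally_acyclic.
  by exists n, (ftgt k).
exists (coker_complex X); split; first exact: coker_totally_acyclic.
exists n, (coker_map k).
apply/(mod_kernelP (coker_map (mdiff X n (n + 1))) (coker_map k)); split.
- apply: lin_injP => z; have [y <-] := coker_proj_surj z.
  rewrite coker_mapE => /coker_proj_eq0[p pE].
  (* The image of [p] is a cycle of the target, so [p] is a cycle of the source by injectivity one
     degree up. *)
  have [x xE] : exists x, fsrc k x = p.
    apply: kerk1; apply: (injX (n + 1)).
    by rewrite morE pE dk2 linear0.
  apply/coker_proj_eq0; exists x; apply: inj2.
  by rewrite -morE xE.
- move=> z; have [y <-] := coker_proj_surj z.
  by rewrite !coker_mapE dk2 linear0.
move=> z; have [t <-] := coker_proj_surj z.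
rewrite coker_mapE => /coker_proj_eq0[p pE].
(* Here [p] is a cycle in degree [n + 1], hence [d w] for some [w]; subtracting the image of [w]
   makes [t] a genuine cycle without changing its class. *)
have [|w wE] := (exP n (n + 1) (n + 1 + 1) erefl erefl).2 p.
  apply: (injX (n + 1 + 1)); rewrite linear0 [LHS]morE pE.
  exact: (ftgt_congr (cd_cd X _ _ _) t).
have [|y yE] := kerk2 (t - marr _ w).
  by rewrite linearB -morE [fsrc _ w]wE pE subrr.
by exists (coker_proj _ y); rewrite coker_mapE yE linearB coker_proj_arr subr0.
Qed.

(** Both modules are presented as cycles in degree 2. The lift [t] of the cover [e] determines the
    component of [sigma] from degree 0 to 1, and the target of [alpha] is recovered as the cycles of
    the twisted sum in degree 2. *)
Lemma gorenstein_projective_of_parts (alpha : morob R) (C : lmodType R)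
    (q : {linear mtgt alpha -> C}) :
  injective (marr alpha) -> surj q ->
  (forall y, q y = 0 <-> exists x, marr alpha x = y) ->
  gorenstein_projective (msrc alpha : Mod R) ->
  gorenstein_projective (C : Mod R) ->
  gorenstein_projective (alpha : Mor R).
Proof.
set a := marr alpha => inja q_surj q0.
move=> /mod_gorenstein_projectiveP/(_ 2)[P [taP [k [k_inj [dk kerk]]]]].
move=> /mod_gorenstein_projectiveP/(_ 2)[Q [taQ [c [c_inj [dc kerc]]]]].
have /mod_totally_acyclicP[_ exP _] := taP.
have /mod_totally_acyclicP[projQ exQ _] := taQ.
have qa x : q (a x) = 0 by apply/q0; exists x.
have [e eE] : exists e : {linear cterm Q 1 -> C},
    forall y, c (e y) = cdiff Q 1 2 y.
  by apply: factor_inj => // y; apply: kerc; rewrite cdiff_cdiff.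
have e_surj : surj e.
  move=> z; have [y yE] := (exQ 1 2 (2 + 1) erefl erefl).2 (c z) (dc z).
  by exists y; apply: c_inj; rewrite eE.
have [t tE] := (mod_projectiveP _).1 (projQ 1) _ _ _ q_surj e.
(* Composing [t] with the differential and then [q] gives [e d = 0], so [t d] factors through
   [a]. *)
have [s sE] : exists s : {linear cterm Q 0 -> msrc alpha},
    forall y, a (s y) = t (cdiff Q 0 1 y).
  apply: (factor_inj (u := lin_comp t (cdiff Q 0 1))) => // y; apply/q0.
  by apply: c_inj; rewrite /= tE eE cdiff_cdiff linear0.
(* The sign makes k and sigma 1 2 agree on the kernel of (x, y) |-> a x + t y. *)
have [y|s0 s0E] := projective_lift (projQ 0) (exP 1 2 (2 + 1) erefl erefl)
    (u := lin_sub (lin_zero _ _) (lin_comp k s)).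
  by rewrite /= sub0r linearN dk oppr0.
have [y|sigma [sigma0 sigma_shape sigma_anti]] :=
    anti_chain_map_exists (s0 := s0) taP taQ.
  have sd : s (cdiff Q (-1) 0 y) = 0.
    by apply: inja; rewrite sE cdiff_cdiff !linear0.
  by rewrite s0E /= sd linear0 subrr.
have sigma1 y : sigma 1 2 (cdiff Q 0 1 y) = k (s y).
  have /eqP := sigma_anti 0 1 2 y.
  by rewrite sigma0 s0E /= sub0r addrC subr_eq0 => /eqP.
(* The target of [alpha] is a quotient of source plus [Q 1], with kernel the pairs [(- s w, d w)].
   Maps out of the target can thus be defined on that sum. *)
pose m := lin_copair a t.
have aty y : e y = 0 -> exists w, cdiff Q 0 1 w = y.
  by move=> ey; apply: (exQ 0 1 2 erefl erefl).2; rewrite -eE ey linear0.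
have m_surj : surj m.
  move=> y; have [z zE] := e_surj (q y).
  have [|x xE] := (q0 (y - t z)).1; first by rewrite linearB tE zE subrr.
  by exists (x, z); rewrite /= xE subrK.
have [[x y] /= mxy|g gE] :=
    factor_surj (f := lin_copair k (sigma 1 2)) m_surj.
  have [|w wE] := aty y.
    by move: (congr1 q mxy); rewrite linearD qa tE add0r linear0.
  have -> : x = - s w.
    apply: inja; rewrite linearN sE wE; apply/eqP.
    by rewrite -addr_eq0 mxy.
  by rewrite -wE sigma1 linearN addNr.
have ga x : g (a x) = k x.
  by have := gE (x, 0); rewrite /= !linear0 !addr0.
have gm x y : g (m (x, y)) = k x + sigma 1 2 y by exact: gE (x, y).
have cqm x y : c (q (m (x, y))) = cdiff Q 1 2 y.
  by rewrite /= !linearD qa tE eE linear0 add0r.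
pose Y := ext_complex sigma_shape sigma_anti.
(* On [m (x, y)] this takes the value [(k x + sigma y, d y)]. *)
pose K : {linear mtgt alpha -> mtgt (ext_term P Q 2)} :=
  lin_pair g (lin_comp c q).
have sqK x : marr (ext_term P Q 2) (k x) = K (a x).
  by rewrite /= ga qa linear0.
exists Y; split; first exact: ext_totally_acyclic.
exists 2, (@mkmor _ alpha (ext_term P Q 2) k K sqK).
apply/(mor_kernelP (ext_mor sigma 2 (2 + 1))).
split; apply/mod_kernelP; split=> //.
- apply: lin_injP => y /= [gy /eqP].
  rewrite -(linear0 c) (inj_eq c_inj) => /eqP/q0[x xE].
  by move: gy; rewrite -xE ga -(linear0 k) => /k_inj ->; rewrite linear0.
- move=> z; have [[x y] <-] := m_surj z.
  rewrite /= gm cqm linearD dk add0r.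
  by rewrite sigma_anti cdiff_cdiff.
move=> [p z] [pz0 z0].
have [y yE] := (exQ 1 2 (2 + 1) erefl erefl).2 z z0.
(* As in the exactness of the twisted complex, [p - sigma y] is a cycle of [P], hence [k x] for some
   [x]; then [m (x, y)] is the preimage. *)
have [|x xE] := kerk (p - sigma 1 2 y).
  move: (sigma_anti 1 2 (2 + 1) y) => /eqP.
  by rewrite addr_eq0 linearB yE => /eqP ->; rewrite opprK.
exists (m (x, y)); rewrite -[LHS]/(g (m (x, y)), c (q (m (x, y)))).
by rewrite gm cqm xE subrK yE.
Qed.

End Correspondence.

Theorem corollary3p6 (R : comPzRingType) (noethR : noetherian R)
    (dualR : exists D : complex (Mod R), dualizing D) (alpha : Mor R) :
  gorenstein_projective alpha <->
  [/\ injective (marr alpha),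
      gorenstein_projective (msrc alpha : Mod R),
      gorenstein_projective (mtgt alpha : Mod R) &
      exists (Q : Mod R) (q : hom_set (mtgt alpha : Mod R) Q),
        is_cokernel (marr alpha : hom_set (msrc alpha : Mod R) (mtgt alpha)) q
        /\ gorenstein_projective Q].
Proof.
split=> [/gorenstein_projective_parts[inja gpX gpT gpC]|].
  split=> //; exists (coker_mod alpha), (coker_proj alpha); split=> //.
  apply/mod_cokernelP; split; first exact: coker_proj_surj.
  exact: coker_proj_eq0.
case=> inja gpX _ [C [q [/(mod_cokernelP _ q)[q_surj q0] gpC]]].
exact: (gorenstein_projective_of_parts inja q_surj q0 gpX gpC).
Qed.
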